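(* Let $\mathbf{k}$ be a field of characteristic zero, and let $P$ be an arbitrary pseudo-involution in the Riordan group $\mathcal{R}$ over $\mathbf{k}$. Let $g(x)\in\mathbf{F}_0$ and $f(x)\in\mathbf{F}_1$ be arbitrary. Then the Riordan array $$(g(x), f(x))^{-1}\cdot P\cdot (g(-x), f(-x))$$ is an involution in $\mathcal{R}$.
   Context: Let $\mathbf{k}$ be a field of characteristic zero. $\mathbf{F}_0$ is the set of formal power series $g(x)=g_0+g_1x+g_2x^2+\cdots$ over $\mathbf{k}$ with $g_0\neq 0$; $\mathbf{F}_1$ is the set of formal power series $f(x)=f_1x+f_2x^2+\cdots$ over $\mathbf{k}$ with zero constant term and $f_1\neq 0$. The Riordan group is $\mathcal{R}=\{(g(x),f(x)) : g\in\mathbf{F}_0,\ f\in\mathbf{F}_1\}$ with product $$(g(x),f(x))\cdot(u(x),v(x))=(g(x)\,u(f(x)),\ v(f(x))),$$ identity $(1,x)$, and inverse $(g(x),f(x))^{-1}=\left(\frac{1}{g(\bar f(x))},\bar f(x)\right)$, where $\bar f$ is the compositional inverse of $f$. Elements of $\mathcal{R}$ are called Riordan arrays (the pair $(g,f)$ is identified with the lower-triangular matrix with $(n,k)$ entry $[x^n]g(x)f(x)^k$, the product corresponding to matrix multiplication). An involution in $\mathcal{R}$ is an element $A\in\mathcal{R}$ with $A\cdot A=(1,x)$. A pseudo-involution in $\mathcal{R}$ is an element $(g(x),f(x))\in\mathcal{R}$ such that $(g(x),f(x))\cdot(1,-x)=(g(x),-f(x))$ is an involution. *)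

(* Defs.v *)
From HB Require Import structures.
From mathcomp Require Import all_boot all_algebra all_fingroup.
From mathcomp Require Import boolp.

Set Implicit Arguments.
Unset Strict Implicit.
Unset Printing Implicit Defensive.

Import GRing.Theory.
Local Open Scope ring_scope.

(* Formal power series over R, as coefficient sequences. They are wrapped in a
   record because their product is the Cauchy product, not the pointwise one. *)
Record fps (R : Type) := FPS { coefs : nat -> R }.

HB.instance Definition _ (R : Type) := gen_eqMixin (fps R).
HB.instance Definition _ (R : Type) := gen_choiceMixin (fps R).

Section FpsRing.
Variable R : comNzRingType.
Implicit Types a b c : fps R.

Lemma fpsP a b : coefs a =1 coefs b -> a = b.
Proof. by case: a b => [a] [b] /= /funext ->. Qed.

Definition fps_zero : fps R := FPS (fun=> 0).
Definition fps_opp a : fps R := FPS (fun n => - coefs a n).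
Definition fps_add a b : fps R := FPS (fun n => coefs a n + coefs b n).
Definition fps_one : fps R := FPS (fun n => (n == 0%N)%:R).
Definition fps_mul a b : fps R :=
  FPS (fun n => \sum_(i < n.+1) coefs a i * coefs b (n - i)%N).

Fact fps_addA : associative fps_add.
Proof. by move=> a b c; apply: fpsP => n /=; rewrite addrA. Qed.
Fact fps_addC : commutative fps_add.
Proof. by move=> a b; apply: fpsP => n /=; rewrite addrC. Qed.
Fact fps_add0 : left_id fps_zero fps_add.
Proof. by move=> a; apply: fpsP => n /=; rewrite add0r. Qed.
Fact fps_addN : left_inverse fps_zero fps_opp fps_add.
Proof. by move=> a; apply: fpsP => n /=; rewrite addNr. Qed.

HB.instance Definition _ :=
  GRing.isZmodule.Build (fps R) fps_addA fps_addC fps_add0 fps_addN.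

Definition fps_trunc N a : {poly R} := \poly_(i < N) coefs a i.

Fact fps_mul_trunc N a b n : (n < N)%N ->
  coefs (fps_mul a b) n = (fps_trunc N a * fps_trunc N b)`_n.
Proof.
move=> nN; rewrite coefM; apply: eq_bigr => i _ /=.
rewrite !coef_poly (leq_ltn_trans _ nN) ?leq_ord //.
by rewrite (leq_ltn_trans (leq_subr _ _) nN).
Qed.

Fact fps_mulC : commutative fps_mul.
Proof.
by move=> a b; apply: fpsP => n; rewrite !(@fps_mul_trunc n.+1) // mulrC.
Qed.

Fact fps_mulA : associative fps_mul.
Proof.
move=> a b c; apply: fpsP => n.
have E x y z : coefs (fps_mul x (fps_mul y z)) n =
   (fps_trunc n.+1 x * (fps_trunc n.+1 y * fps_trunc n.+1 z))`_n.
  rewrite [RHS]coefM; apply: eq_bigr => i _.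
  by rewrite (@fps_mul_trunc n.+1) ?ltnS ?leq_subr // coef_poly ltn_ord.
rewrite E (fps_mulC _ c) E mulrA.
by rewrite [_ * _ * fps_trunc _ c]mulrC.
Qed.

Fact fps_mul1 : left_id fps_one fps_mul.
Proof.
move=> a; apply: fpsP => n /=; rewrite big_ord_recl /= mul1r subn0.
by rewrite big1 ?addr0 // => i _; rewrite mul0r.
Qed.

Fact fps_mulDl : left_distributive fps_mul fps_add.
Proof.
move=> a b c; apply: fpsP => n /=; rewrite -big_split /=.
by apply: eq_bigr => i _; rewrite mulrDl.
Qed.

Fact fps_one_neq0 : fps_one != 0.
Proof.
apply/eqP => /(congr1 (fun a => coefs a 0)) /= /eqP.
by rewrite (negbTE (oner_neq0 R)).
Qed.

HB.instance Definition _ := GRing.Zmodule_isComNzRing.Build (fps R)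
  fps_mulA fps_mulC fps_mul1 fps_mulDl fps_one_neq0.

Definition fpsX : fps R := FPS (fun n => (n == 1%N)%:R).

(* The substitution u(f(x)) = sum_i u_i f(x)^i, for f with zero constant term;
   then f^i starts in degree i, so only i <= n contributes to the n-th
   coefficient. *)
Definition fps_comp (u f : fps R) : fps R :=
  FPS (fun n => \sum_(i < n.+1) coefs u i * coefs (f ^+ i) n).

Lemma coefs_comp u f n :
  coefs (fps_comp u f) n = \sum_(i < n.+1) coefs u i * coefs (f ^+ i) n.
Proof. by []. Qed.
Lemma coefs0 n : coefs (0 : fps R) n = 0. Proof. by []. Qed.
Lemma coefsD a b n : coefs (a + b) n = coefs a n + coefs b n. Proof. by []. Qed.
Lemma coefsN a n : coefs (- a) n = - coefs a n. Proof. by []. Qed.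
Lemma coefs1 n : coefs (1 : fps R) n = (n == 0%N)%:R. Proof. by []. Qed.
Lemma coefsM a b n :
  coefs (a * b) n = \sum_(i < n.+1) coefs a i * coefs b (n - i)%N.
Proof. by []. Qed.
Lemma coefs_sum I (r : seq I) (P : pred I) (F : I -> fps R) n :
  coefs (\sum_(i <- r | P i) F i) n = \sum_(i <- r | P i) coefs (F i) n.
Proof. by apply: (big_morph (fun a => coefs a n)). Qed.

Lemma coefs0M a b : coefs (a * b) 0 = coefs a 0 * coefs b 0.
Proof. by rewrite coefsM big_ord_recl big_ord0 addr0. Qed.

Lemma coefsX_small (f : fps R) i n :
  coefs f 0 = 0 -> (n < i)%N -> coefs (f ^+ i) n = 0.
Proof.
move=> f0; elim: i n => // i IH n ni; rewrite exprS coefsM big1 // => -[j jn] _ /=.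
case: j jn => [|j] jn; first by rewrite f0 mul0r.
by rewrite IH ?mulr0 // ltn_subLR // addSn; apply: leq_trans ni _; rewrite ltnS leq_addl.
Qed.

Lemma coefsX_diag (f : fps R) n :
  coefs f 0 = 0 -> coefs (f ^+ n) n = coefs f 1 ^+ n.
Proof.
move=> f0; elim: n => // n IH; rewrite exprS coefsM big_ord_recl f0 mul0r add0r.
rewrite big_ord_recl /= subn1 IH -exprS big1 ?addr0 // => i _.
by rewrite coefsX_small ?mulr0 // /bump /= !add1n subSS ltn_subLR ?addSn ?ltnS ?leq_addl // ltn_ord.
Qed.

Lemma fps_compE N (u f : fps R) n : coefs f 0 = 0 -> (n < N)%N ->
  coefs (fps_comp u f) n = \sum_(i < N) coefs u i * coefs (f ^+ i) n.
Proof.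
move=> f0 nN /=.
rewrite (big_ord_widen N (fun i => coefs u i * coefs (f ^+ i) n)) //.
rewrite big_mkcond; apply: eq_bigr => i _; case: ifP => // /negbT.
by rewrite -leqNgt => ni; rewrite coefsX_small ?mulr0.
Qed.

Lemma fps_comp_coef0 (u f : fps R) : coefs (fps_comp u f) 0 = coefs u 0.
Proof. by rewrite coefs_comp big_ord_recl big_ord0 expr0 coefs1 mulr1 addr0. Qed.

Lemma fps_comp_coef1 (u f : fps R) : coefs f 0 = 0 ->
  coefs (fps_comp u f) 1 = coefs u 1 * coefs f 1.
Proof.
move=> f0; rewrite coefs_comp !big_ord_recl big_ord0 expr0 coefs1 mulr0 add0r addr0.
by rewrite expr1.
Qed.

Lemma fps_comp1 (f : fps R) : fps_comp 1 f = 1.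
Proof.
apply: fpsP => n; rewrite coefs_comp big_ord_recl expr0 !coefs1 mul1r big1 ?addr0 //.
by move=> i _; rewrite coefs1 mul0r.
Qed.

Lemma fps_compM (u w f : fps R) : coefs f 0 = 0 ->
  fps_comp (u * w) f = fps_comp u f * fps_comp w f.
Proof.
move=> f0; apply: fpsP => n.
have L : coefs (fps_comp (u * w) f) n = \sum_(i < n.+1) \sum_(j < n.+1)
    coefs u i * coefs w j * coefs (f ^+ (i + j)) n.
  pose F i j := coefs u i * coefs w j * coefs (f ^+ (i + j)) n.
  transitivity (\sum_(m < n.+1) \sum_(i < m.+1) F i (m - i)%N).
    apply: eq_bigr => m _; rewrite coefsM mulr_suml; apply: eq_bigr => i _.
    by rewrite /F subnKC // -ltnS.
  transitivity (\sum_(m < n.+1) \sum_(i < n.+1 | (i <= m)%N) F i (m - i)%N).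
    apply: eq_bigr => m _.
    by rewrite (big_ord_widen n.+1 (fun i => F i (m - i)%N)).
  rewrite (exchange_big_dep xpredT) //=; apply: eq_bigr => i _.
  rewrite -(big_mkord (fun m => i <= m)%N (fun m => F i (m - i)%N)).
  rewrite (big_cat_nat (n := i)) ?leq0n ?(ltnW (ltn_ord i)) //=.
  rewrite big_nat_cond big1 ?add0r; last first.
    by move=> m /andP[/andP[_ mi]]; rewrite leqNgt mi.
  rewrite big_nat_cond (eq_bigl (fun m => (i <= m < n.+1)%N && true)); last first.
    by move=> m; case: (i <= m)%N; rewrite ?andbF ?andbT.
  rewrite -big_nat_cond -{1}[i : nat]add0n big_addn big_mkord.
  rewrite (big_ord_widen n.+1 (fun j => F i (j + i - i)%N)) ?leq_subr //.
  rewrite big_mkcond; apply: eq_bigr => j _; rewrite addnK; case: ifP => // /negbT.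
  rewrite -leqNgt leq_subLR => h.
  by rewrite /F coefsX_small ?mulr0.
rewrite L coefsM.
transitivity (\sum_(l < n.+1) \sum_(i < n.+1) \sum_(j < n.+1)
    coefs u i * coefs (f ^+ i) l * (coefs w j * coefs (f ^+ j) (n - l)%N)).
  rewrite [RHS]exchange_big; apply: eq_bigr => i _ /=.
  rewrite [RHS]exchange_big; apply: eq_bigr => j _ /=.
  rewrite exprD coefsM mulr_sumr; apply: eq_bigr => l _.
  by rewrite mulrACA.
apply: eq_bigr => l _; rewrite (@fps_compE n.+1) // (@fps_compE n.+1) //.
  by rewrite big_distrlr.
by rewrite ltnS leq_subr.
Qed.

Lemma fps_compX (u f : fps R) m : coefs f 0 = 0 ->
  fps_comp (u ^+ m) f = fps_comp u f ^+ m.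
Proof.
by move=> f0; elim: m => [|m IH]; rewrite ?expr0 ?fps_comp1 // !exprS fps_compM // IH.
Qed.

Lemma fps_compA (u v f : fps R) : coefs v 0 = 0 -> coefs f 0 = 0 ->
  fps_comp u (fps_comp v f) = fps_comp (fps_comp u v) f.
Proof.
move=> v0 f0; apply: fpsP => n; rewrite coefs_comp [RHS]coefs_comp.
under [RHS]eq_bigr => m _ do rewrite (@fps_compE n.+1 u v m) ?ltn_ord // mulr_suml.
rewrite exchange_big; apply: eq_bigr => i _ /=.
rewrite -fps_compX // coefs_comp mulr_sumr; apply: eq_bigr => m _.
by rewrite mulrA.
Qed.

Lemma fps_compXl (f : fps R) : coefs f 0 = 0 -> fps_comp fpsX f = f.
Proof.
move=> f0; apply: fpsP => n; rewrite (@fps_compE n.+2) //.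
rewrite !big_ord_recl /= mul0r add0r mul1r expr1 big1 ?addr0 // => i _.
by rewrite mul0r.
Qed.

Lemma coefs_XM (a : fps R) n : coefs (fpsX * a) n.+1 = coefs a n.
Proof.
rewrite coefsM !big_ord_recl /= mul0r add0r mul1r subSS subn0.
by rewrite big1 ?addr0 // => i _; rewrite mul0r.
Qed.

Lemma coefs_Xn i n : coefs (fpsX ^+ i) n = (n == i)%:R.
Proof.
elim: i n => [|i IH] [|n] //; rewrite exprS; last by rewrite coefs_XM IH.
by rewrite coefs0M mul0r.
Qed.

Lemma fps_compXr (u : fps R) : fps_comp u fpsX = u.
Proof.
apply: fpsP => n /=; rewrite big_ord_recr /= coefs_Xn eqxx mulr1 big1 ?add0r //.
by move=> i _; rewrite coefs_Xn gtn_eqF ?mulr0.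
Qed.

End FpsRing.

Section Inverses.
Variable k : fieldType.
Implicit Types a f g : fps k.

(* The solution v of the lower triangular system
   sum_(i <= n) v_i * t n i = b n, for all n. *)
Fixpoint tri_seq (t : nat -> nat -> k) (b : nat -> k) (n : nat) : seq k :=
  if n is m.+1 then
    let s := tri_seq t b m in
    rcons s ((b m - \sum_(i < m) s`_i * t m i) / t m m)
  else [::].

Definition tri_solve t b : fps k := FPS (fun n => (tri_seq t b n.+1)`_n).

Lemma size_tri_seq t b n : size (tri_seq t b n) = n.
Proof. by elim: n => //= n IH; rewrite size_rcons IH. Qed.

Lemma tri_seqE t b n i : (i < n)%N -> (tri_seq t b n)`_i = coefs (tri_solve t b) i.
Proof.
elim: n => // n IH; rewrite ltnS leq_eqVlt => /predU1P[-> //|i_n].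
by rewrite /= nth_rcons size_tri_seq i_n IH.
Qed.

Lemma tri_solveP t b : (forall n, t n n != 0) ->
  forall n, \sum_(i < n.+1) coefs (tri_solve t b) i * t n i = b n.
Proof.
move=> tn0 n; rewrite big_ord_recr /= nth_rcons size_tri_seq ltnn eqxx divfK //.
under eq_bigr => i _ do rewrite -[rcons _ _]/(tri_seq t b i.+1) tri_seqE //.
under [X in _ - X]eq_bigr => i _ do rewrite tri_seqE //.
by rewrite addrC subrK.
Qed.

(* 1/g, for g with nonzero constant term. *)
Definition fps_inv g : fps k :=
  tri_solve (fun n i => coefs g (n - i)) (coefs (1 : fps k)).

Lemma fps_mulVr g : coefs g 0 != 0 -> fps_inv g * g = 1.
Proof.
move=> g0; apply: fpsP => n; rewrite coefsM.
by rewrite (@tri_solveP (fun n i => coefs g (n - i))) // => m; rewrite subnn.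
Qed.

(* The compositional inverse of f, for f in F1: the solution v of v(f(x)) = x.
   That it is two-sided is [fps_comp_cinv] and [fps_cinv_comp]. *)
Definition fps_cinv f : fps k :=
  tri_solve (fun n i => coefs (f ^+ i) n) (coefs (fpsX k)).

Definition F0 : {pred fps k} := fun g => coefs g 0 != 0.
Definition F1 : {pred fps k} := fun f => (coefs f 0 == 0) && (coefs f 1 != 0).

Lemma F1_0 f : f \in F1 -> coefs f 0 = 0.
Proof. by case/andP=> /eqP. Qed.

Lemma fps_cinv_comp f : f \in F1 -> fps_comp (fps_cinv f) f = fpsX k.
Proof.
move=> /andP[/eqP f0 f1]; apply: fpsP => n.
apply: (@tri_solveP (fun n i => coefs (f ^+ i) n)) => m.
by rewrite coefsX_diag // expf_neq0.
Qed.

Lemma F1_X : fpsX k \in F1.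
Proof. by rewrite unfold_in /= eqxx oner_neq0. Qed.

Lemma F0_1 : (1 : fps k) \in F0.
Proof. exact: oner_neq0. Qed.

Lemma F0_M a b : a \in F0 -> b \in F0 -> a * b \in F0.
Proof. by rewrite !unfold_in /F0 coefs0M => *; rewrite mulf_neq0. Qed.

Lemma F0_comp g f : g \in F0 -> fps_comp g f \in F0.
Proof. by rewrite !unfold_in /F0 fps_comp_coef0. Qed.

Lemma F1_comp u f : u \in F1 -> f \in F1 -> fps_comp u f \in F1.
Proof.
move=> /andP[u0 u1] f1; rewrite unfold_in /F1 fps_comp_coef0 u0 fps_comp_coef1 ?F1_0 //.
by rewrite mulf_neq0 //; case/andP: f1.
Qed.

Lemma F1_opp f : f \in F1 -> - f \in F1.
Proof. by rewrite !unfold_in /F1 !coefsN !oppr_eq0. Qed.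

Lemma F0_inv g : g \in F0 -> fps_inv g \in F0.
Proof.
move/fps_mulVr; move: (fps_inv g) => v /(congr1 (fun a => coefs a 0)).
rewrite coefs0M => e; apply/eqP => h; move/eqP: e.
by rewrite h mul0r eq_sym (negbTE (oner_neq0 k)).
Qed.

Lemma F1_cinv f : f \in F1 -> fps_cinv f \in F1.
Proof.
move=> f1; move: (fps_cinv f) (fps_cinv_comp f1) => v e.
rewrite unfold_in /F1 -(fps_comp_coef0 _ f) e eqxx /=.
apply/eqP => h; move/(congr1 (fun a => coefs a 1)): e.
rewrite fps_comp_coef1 ?F1_0 // h mul0r => /eqP.
by rewrite eq_sym (negbTE (oner_neq0 k)).
Qed.

Lemma fps_comp_cinv f : f \in F1 -> fps_comp f (fps_cinv f) = fpsX k.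
Proof.
move=> f1; set v := fps_cinv f; have v1 : v \in F1 := F1_cinv f1.
have w1 := F1_cinv v1.
rewrite -[f in LHS]fps_compXl ?F1_0 // -{1}(fps_cinv_comp v1).
rewrite -!fps_compA ?F1_0 ?F1_comp //.
by rewrite (fps_compA v) ?F1_0 // fps_cinv_comp // fps_compXl ?F1_0 // fps_cinv_comp.
Qed.

End Inverses.

Arguments F0 {k}.
Arguments F1 {k}.

(* The Riordan group; the element (g, f) stands for the lower triangular matrix
   with (n, j) entry coefs (g * f ^+ j) n. *)
Record riordan (k : fieldType) := Riordan {
  rg : fps k;
  rf : fps k;
  rgP : rg \in F0;
  rfP : rf \in F1 }.

HB.instance Definition _ (k : fieldType) := gen_eqMixin (riordan k).
HB.instance Definition _ (k : fieldType) := gen_choiceMixin (riordan k).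

Section RiordanGroup.
Variable k : fieldType.
Implicit Types A B : riordan k.

Lemma riordanP A B : rg A = rg B -> rf A = rf B -> A = B.
Proof.
case: A B => [g f hg hf] [u v hu hv] /= gu fv.
case: u / gu hu => hu; case: v / fv hv => hv.
by rewrite (bool_irrelevance hg hu) (bool_irrelevance hf hv).
Qed.

Definition riordan_one : riordan k := Riordan (F0_1 k) (F1_X k).

Definition riordan_mul A B : riordan k :=
  Riordan (F0_M (rgP A) (F0_comp (rf A) (rgP B))) (F1_comp (rfP B) (rfP A)).

Definition riordan_inv A : riordan k :=
  Riordan (F0_inv (F0_comp (fps_cinv (rf A)) (rgP A))) (F1_cinv (rfP A)).

Fact riordan_mulA : associative riordan_mul.
Proof.
move=> A B C; have A0 := F1_0 (rfP A); have B0 := F1_0 (rfP B).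
apply: riordanP => /=; last by rewrite fps_compA.
by rewrite fps_compM // fps_compA // mulrA.
Qed.

Fact riordan_mul1 : left_id riordan_one riordan_mul.
Proof. by move=> A; apply: riordanP => /=; rewrite ?mul1r fps_compXr. Qed.

Fact riordan_mulr1 : right_id riordan_one riordan_mul.
Proof.
move=> A; apply: riordanP => /=; first by rewrite fps_comp1 mulr1.
by rewrite fps_compXl // F1_0 // rfP.
Qed.

Fact riordan_mulV : left_inverse riordan_one riordan_inv riordan_mul.
Proof.
move=> A; apply: riordanP => /=; last by rewrite fps_comp_cinv // rfP.
by rewrite fps_mulVr //; apply: (F0_comp _ (rgP A)).
Qed.

Fact riordan_mulrV : right_inverse riordan_one riordan_inv riordan_mul.
Proof.
move=> A; rewrite -[LHS]riordan_mul1 -{1}(riordan_mulV (riordan_inv A)).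
rewrite -riordan_mulA (riordan_mulA (riordan_inv A)) riordan_mulV riordan_mul1.
exact: riordan_mulV.
Qed.

HB.instance Definition _ := isGroup.Build (riordan k)
  riordan_mulA riordan_mul1 riordan_mulr1 riordan_mulV riordan_mulrV.

Definition is_involution A : Prop := (A * A = 1)%g.

Definition one_negx : riordan k := Riordan (F0_1 k) (F1_opp (F1_X k)).

Definition is_pseudo_involution A : Prop := is_involution (A * one_negx)%g.

End RiordanGroup.

(* g(-x) *)
Definition fps_negx (k : fieldType) (g : fps k) : fps k := fps_comp g (- fpsX k).

Lemma F0_negx (k : fieldType) (g : fps k) : g \in F0 -> fps_negx g \in F0.
Proof. exact: F0_comp. Qed.

Lemma F1_negx (k : fieldType) (f : fps k) : f \in F1 -> fps_negx f \in F1.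
Proof. by move=> hf; apply: F1_comp hf (F1_opp (F1_X k)). Qed.

Lemma coefs_negx (k : fieldType) (g : fps k) n :
  coefs (fps_negx g) n = (-1) ^+ n * coefs g n.
Proof.
have S i (a : fps k) : coefs ((-1) ^+ i * a) n = (-1) ^+ i * coefs a n.
  elim: i => [|i IH]; first by rewrite !expr0 !mul1r.
  by rewrite !exprS -!mulrA !mulN1r coefsN IH.
have E i : coefs ((- fpsX k) ^+ i) n = (-1) ^+ i * (n == i)%:R.
  by rewrite [in LHS]exprNn S coefs_Xn.
rewrite coefs_comp big_ord_recr /= E eqxx mulr1 mulrC big1 ?add0r //.
by move=> i _; rewrite E gtn_eqF // !mulr0.
Qed.

(* Main.v *)
(* Since (g(-x), f(-x)) = (1, -x) (g, f), the array is the conjugate by (g, f)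
   of the involution P (1, -x). *)
Require Import Defs.
From HB Require Import structures.
From mathcomp Require Import all_boot all_algebra all_fingroup.

(** The product rule with left factor [(1, -x)] substitutes [-x] into both series of the right
    factor. *)
Lemma riordan_negxE (k : fieldType) (g f : fps k) (hg : g \in F0) (hf : f \in F1) :
  Riordan (F0_negx hg) (F1_negx hf) = (one_negx k * Riordan hg hf)%g.
Proof. by apply: riordanP => //=; rewrite GRing.mul1r. Qed.

(** Conjugation by [B] is multiplicative and fixes [1], so it preserves [A * A = 1]. *)
Lemma is_involution_conj (k : fieldType) (A B : riordan k) :
  is_involution A -> is_involution (A ^ B)%g.
Proof. by rewrite /is_involution -conjMg => ->; rewrite conj1g. Qed.

Theorem proposition7 (k : fieldType) (char0 : [pchar k]%R =i pred0)
    (P : riordan k) (hP : is_pseudo_involution P)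
    (g f : fps k) (hg : g \in F0) (hf : f \in F1) :
  is_involution
    ((Riordan hg hf)^-1 * P * Riordan (F0_negx hg) (F1_negx hf))%g.
Proof.
(* Reassociating moves [one_negx] next to [P]: the array becomes [(P * one_negx) ^ B] with
   [B = Riordan hg hf], and [hP] says that the conjugated element is an involution. *)
rewrite riordan_negxE -mulgA (mulgA P) -conjgE.
exact: is_involution_conj.
Qed.
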